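(* Let $T=(V,E,w)$ be a weighted tree and let $i,j\in V$ be fixed with $i\ne j$. For $x\sim i$ write $\sigma_{ix}=-1$ if the edge $\{i,x\}$ is on the geodesic $P^\ast_{ij}$ and $\sigma_{ix}=1$ otherwise; similarly for $y\sim j$ write $\sigma_{jy}=-1$ if $\{j,y\}$ is on $P^\ast_{ij}$ and $\sigma_{jy}=1$ otherwise. Then the Lin-Lu-Yau curvature is $$\kappa^{\mathsf{lly}}_{ij}=-\frac{1}{\Delta(i,j)}\left(\sum_{x\sim i}\frac{w_{ix}\sigma_{ix}}{\mathrm{d}_w(i)}+\sum_{y\sim j}\frac{w_{jy}\sigma_{jy}}{\mathrm{d}_w(j)}\right).$$
   Context: A tree is a finite, simple, connected, acyclic graph; a weighted tree $T=(V,E,w)$ has $V=\{1,\dots,n\}$ and strictly positive edge weights $w_{ij}=w_{ji}$ for $\{i,j\}\in E$. Write $i\sim j$ if $\{i,j\}\in E$. The weighted degree is $\mathrm{d}_w(i)=\sum_{x\sim i}w_{ix}$. $\Delta(i,j)$ is the unweighted shortest path distance (number of edges in a shortest path), and $P^\ast_{ij}$, the geodesic, is the unique shortest path from $i$ to $j$. For $\alpha\in[0,1)$ and $i\in V$, the $\alpha$-lazy random walk measure $m_i^{(\alpha)}$ is the probability measure on $V$ with $m_i^{(\alpha)}(i)=\alpha$, $m_i^{(\alpha)}(x)=(1-\alpha)w_{ix}/\mathrm{d}_w(i)$ if $x\sim i$, and $m_i^{(\alpha)}(x)=0$ otherwise. For probability measures $\mu,\nu$ on $V$, $$\mathsf{W}_1(\mu,\nu)=\inf\Big\{\sum_{i,j\in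 V}\pi_{ij}\Delta(i,j):\ \pi\in\mathbb{R}^{n\times n},\ \pi_{ij}\ge 0,\ \mathbf{1}^T\pi=\mu^T,\ \pi\mathbf{1}=\nu\Big\},$$ where $\mathbf 1$ is the all-ones vector. For $i\ne j$, the Ollivier-Ricci curvature is $\kappa^{\mathsf{or},\alpha}_{ij}=1-\mathsf{W}_1(m_i^{(\alpha)},m_j^{(\alpha)})/\Delta(i,j)$, and the Lin-Lu-Yau curvature is $\kappa^{\mathsf{lly}}_{ij}=\lim_{\alpha\to1^-}\kappa^{\mathsf{or},\alpha}_{ij}/(1-\alpha)$. *)

(* Defs.v *)
From HB Require Import structures.
From mathcomp Require Import all_boot all_order all_algebra.
From mathcomp Require Import all_classical all_reals all_analysis.

Set Implicit Arguments.
Unset Strict Implicit.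
Unset Printing Implicit Defensive.

Import Order.TTheory GRing.Theory Num.Theory.
Import numFieldNormedType.Exports.

Local Open Scope classical_set_scope.
Local Open Scope ring_scope.

(* Acyclicity: [ucycle] is a closed walk without repeated vertices; those with
   at most 2 vertices are the empty one, loops, and an edge traversed back and
   forth.  The values of [weight] at non-adjacent pairs are never used. *)
Record weighted_tree (R : realType) (n : nat) := WeightedTree {
  adj : rel 'I_n;
  weight : 'I_n -> 'I_n -> R;
  adj_irr : irreflexive adj;
  adj_sym : symmetric adj;
  tree_connected : forall i j, connect adj i j;
  tree_acyclic : forall c : seq 'I_n, ucycle adj c -> (size c <= 2)%N;
  weight_sym : forall i j, adj i j -> weight i j = weight j i;
  weight_gt0 : forall i j, adj i j -> 0 < weight i j
}.

Section WeightedTree.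
Variables (R : realType) (n : nat) (T : weighted_tree R n).
Implicit Types (i j x y : 'I_n).

Definition walk_of_length i j (k : nat) : pred (k.-tuple 'I_n) :=
  fun p => path (adj T) i p && (last i p == j).

Lemma ex_walk i j : exists k, [exists p, @walk_of_length i j k p].
Proof.
have /connectP[p pP jE] := tree_connected T i j.
exists (size p); apply/existsP; exists (in_tuple p).
by rewrite /walk_of_length /= pP jE eqxx.
Qed.

(* The graph distance: a walk of minimal length is automatically a path. *)
Definition dist i j : nat := ex_minn (ex_walk i j).

Lemma ex_geodesic i j : exists p, @walk_of_length i j (dist i j) p.
Proof. by rewrite /dist; case: ex_minnP => k /existsP. Qed.

(* The vertices, from i to j, of a walk with [dist i j] edges; in a tree there
   is exactly one such walk, so the choice made by [xchoose] is immaterial. *)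
Definition geodesic i j : seq 'I_n := i :: xchoose (ex_geodesic i j).

Definition edge_on (s : seq 'I_n) x y : bool :=
  infix [:: x; y] s || infix [:: y; x] s.

Definition wdeg i : R := \sum_(x | adj T i x) weight T i x.

Definition lazy_walk (alpha : R) i : 'cV[R]_n :=
  \col_x (if x == i then alpha
          else if adj T i x then (1 - alpha) * weight T i x / wdeg i
          else 0).

Definition coupling (mu nu : 'cV[R]_n) : set 'M[R]_n :=
  [set pi : 'M[R]_n |
    [/\ forall i j, 0 <= pi i j,
         (const_mx 1 : 'cV[R]_n)^T *m pi = mu^T
       & pi *m (const_mx 1 : 'cV[R]_n) = nu]].

Definition W1 (mu nu : 'cV[R]_n) : R :=
  inf [set \sum_i \sum_j pi i j * (dist i j)%:R | pi in coupling mu nu].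

Definition ollivier_ricci (alpha : R) i j : R :=
  1 - W1 (lazy_walk alpha i) (lazy_walk alpha j) / (dist i j)%:R.

Definition lly_quotient i j (alpha : R) : R :=
  ollivier_ricci alpha i j / (1 - alpha).

Definition lin_lu_yau i j : R := lim (lly_quotient i j alpha @[alpha --> 1^'-]).

Definition sigma i j v x : R := if edge_on (geodesic i j) v x then -1 else 1.

End WeightedTree.

(* Main.v *)
Require Import Defs.
From HB Require Import structures.
From mathcomp Require Import all_boot all_order all_algebra.
From mathcomp Require Import all_classical all_reals all_analysis.
From mathcomp Require Import zify ring lra.

Set Implicit Arguments.
Unset Strict Implicit.
Unset Printing Implicit Defensive.

Import Order.TTheory GRing.Theory Num.Theory.
Import numFieldNormedType.Exports.

Local Open Scope classical_set_scope.
Local Open Scope ring_scope.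

(** Write [d] for the distance from [i] to [j], and [m_i], [m_j] for the lazy
walk measures.  For laziness [alpha >= 1/2] the optimal transport from [m_i] to
[m_j] has an explicit form, and its cost is [d] plus a constant multiple of
[1 - alpha]; the quotient defining the curvature is therefore constant for
[1/2 <= alpha < 1], and its limit is that constant.

The transport is solved by complementary slackness.  As dual potential take
[pair_potential x y = dist i x + dist y j - d], where [x] is the target of the
transported mass and [y] its source.  It is a function of [x] plus a function of
[y], so its total against a coupling depends on the two marginals only
([coupling_potential]).

- It bounds the cost from below on the support of any coupling: mass moves from
  [i] or a neighbour of [i] to [j] or a neighbour of [j], and there the
  potential is at most [dist x y] ([dist_four_point]).  This is where acyclicity
  enters: a neighbour of [i] other than the first vertex of the geodesic is at
  distance [d + 1] from [j], and dually at the other end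
  ([dist_other_neighbor]).
- It equals the cost wherever the source is [i] or the target is [j], and all
  the mass can be moved that way: the mass of [m_i] off [i] is sent to [j], and
  the mass of [m_j] off [j] is taken from [i] ([hub_coupling]).  What remains to go from [i] to [j] is [2 alpha - 1], so
  this is possible when [alpha >= 1/2].

Evaluating the potential on the marginals leaves the mean distance to [j] after
one step from [i] and vice versa.  One step changes the distance by the sign
[sigma] ([dist_neighbor_source], [dist_neighbor_target]), which turns these
means into the sums of the formula. *)

(** * Distances in a tree *)

Section TreeDistance.
Variables (R : realType) (n : nat) (T : weighted_tree R n).
Implicit Types (i j u v x y : 'I_n).

Lemma dist_walkP x y :
  exists p, [/\ path (adj T) x p, last x p = y & size p = dist T x y].
Proof.
have [p /andP[pP /eqP pl]] := ex_geodesic T x y.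
by exists p; rewrite size_tuple.
Qed.

Lemma dist_le_walk x p : path (adj T) x p -> (dist T x (last x p) <= size p)%N.
Proof.
move=> pP; rewrite /dist; case: ex_minnP => k _; apply.
by apply/existsP; exists (in_tuple p); rewrite /walk_of_length /= pP eqxx.
Qed.

Lemma dist_xx x : dist T x x = 0%N.
Proof. by apply/eqP; rewrite -leqn0; exact: (@dist_le_walk x [::]). Qed.

Lemma dist_eq0 x y : dist T x y = 0%N -> x = y.
Proof.
by move=> d0; have [p [_ pl]] := dist_walkP x y; rewrite d0 -pl => /size0nil->.
Qed.

Lemma dist_adj_le1 x y : adj T x y -> (dist T x y <= 1)%N.
Proof. by move=> xy; apply: (@dist_le_walk x [:: y]); rewrite /= xy. Qed.

Lemma dist_triangle y x z : (dist T x z <= dist T x y + dist T y z)%N.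
Proof.
have [p [pP pl <-]] := dist_walkP x y; have [q [qP ql <-]] := dist_walkP y z.
rewrite -size_cat -ql -pl -last_cat; apply: dist_le_walk.
by rewrite cat_path pP pl.
Qed.

Lemma rev_walk x p : path (adj T) x p ->
  exists q, [/\ path (adj T) (last x p) q, last (last x p) q = x,
                size q = size p & last x p :: q =i x :: p].
Proof.
move=> pP; exists (rev (belast x p)); split.
- by rewrite rev_path (eq_path (e' := adj T)) // => u v; exact: adj_sym.
- by case: p {pP} => //= y p; rewrite rev_cons last_rcons.
- by rewrite size_rev size_belast.
- by move=> u; rewrite in_cons mem_rev -in_cons -mem_rcons -lastI.
Qed.

Lemma dist_sym x y : dist T x y = dist T y x.
Proof.
suff le_sym u v : (dist T u v <= dist T v u)%N by apply/eqP; rewrite eqn_leq !le_sym.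
have [p [pP pl <-]] := dist_walkP v u; have [q [qP ql <- _]] := rev_walk pP.
by move: qP ql; rewrite pl => qP <-; exact: dist_le_walk.
Qed.

Lemma dist_on_walk x p v : path (adj T) x p -> v \in x :: p ->
  (dist T x v + dist T v (last x p) <= size p)%N.
Proof.
move=> /[swap] vp; case/splitPl: vp => q r ql.
rewrite cat_path => /andP[qP rP].
rewrite size_cat last_cat leq_add // -ql; exact: dist_le_walk.
Qed.

(** Removing [v] disconnects its neighbours from one another: a walk from [x]
to [y] that misses [v], once freed of loops, would close up through [v] to a cycle. *)
Lemma neighbors_separated v x y p : adj T v x -> adj T v y ->
  path (adj T) x p -> last x p = y -> v \notin x :: p -> x = y.
Proof.
move=> vx + pP ply; rewrite -{}ply; case/shortenP: pP => q qP qU qp vy vp.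
have : ucycle (adj T) [:: v, x & q].
  apply/andP; split; first by rewrite /= vx rcons_path qP adj_sym.
  rewrite cons_uniq qU andbT; apply: contra vp.
  by rewrite !in_cons => /orP[->//|/qp ->]; rewrite orbT.
by case: q {qP qU qp vy} => // a q /tree_acyclic.
Qed.

(** At most one neighbour of [v] is closer to [u].  If [y] were not farther than
[v], a shortest walk from [y] to [u] followed by one from [u] to [q] would join
two neighbours of [v] without visiting [v]. *)
Lemma dist_other_neighbor u v q y : adj T v q -> adj T v y -> y != q ->
  dist T u v = (dist T u q).+1 -> dist T u y = (dist T u v).+1.
Proof.
move=> vq vy yq dq; apply/eqP; rewrite eqn_leq; apply/andP; split.
  by rewrite -addn1 (leq_trans (dist_triangle v u y)) // leq_add2l dist_adj_le1.
rewrite ltnNge; apply: contra yq => dy; apply/eqP.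
have [p [pP pl ps]] := dist_walkP y u; have [r [rP rl rs]] := dist_walkP u q.
apply: (neighbors_separated (p := p ++ r) vy vq).
- by rewrite cat_path pP pl.
- by rewrite last_cat pl.
rewrite -cat_cons mem_cat; apply/norP; split; apply/negP.
  move=> vp; have := dist_on_walk pP vp; rewrite pl ps (dist_sym y u) (dist_sym v u) => le.
  have /dist_eq0 yv : dist T y v = 0%N by lia.
  by rewrite yv adj_irr in vy.
move=> vr; have : v \in u :: r by rewrite in_cons vr orbT.
by move/(dist_on_walk rP); rewrite rl rs; lia.
Qed.

Lemma geodesicP i j : exists p,
  [/\ geodesic T i j = i :: p, path (adj T) i p, last i p = j & size p = dist T i j].
Proof.
have /andP[gP /eqP gl] := xchooseP (ex_geodesic T i j).
by exists (xchoose (ex_geodesic T i j)); rewrite size_tuple.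
Qed.

(** A walk of minimal length has no slack in the triangle inequalities along it.
In particular an edge that lies on the geodesic at [i] or at [j] can only
be traversed away from [i], respectively towards [j]. *)
Lemma geodesic_step i j a b : infix [:: a; b] (geodesic T i j) ->
  [/\ adj T a b, dist T i b = (dist T i a).+1 & dist T a j = (dist T b j).+1].
Proof.
have [p [-> pP pl ps]] := geodesicP i j; case/infixP => l [r e].
have [ab la rP rl] : [/\ adj T a b, (dist T i a <= size l)%N, path (adj T) b r
    & last b r = j /\ dist T i j = (size l + size r).+1].
  case: l e => [[<- pE]|i' l [_ pE]].
    move: pP pl; rewrite -ps pE /= => /andP[ab rP] rl.
    by rewrite dist_xx.
  move: pP pl; rewrite -ps pE cat_path last_cat => /andP[lP /= /and3P[la ab rP]] rl.
  split=> //; last by rewrite size_cat /= !addSn !addnS.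
  have := @dist_le_walk i (rcons l a).
  by rewrite rcons_path lP la last_rcons size_rcons; apply.
case: rl => rl d; move: rP => /dist_le_walk; rewrite rl => rP.
move: (size l) (size r) la rP d => k m la rP d.
have := dist_triangle a i j; have := dist_triangle b i j.
have := dist_triangle b a j; have := dist_triangle a i b.
have := dist_adj_le1 ab; split=> //; lia.
Qed.

Lemma geodesic_first_edge i j : i != j -> exists x, infix [:: i; x] (geodesic T i j).
Proof.
move=> ij; have [p [-> _ + _]] := geodesicP i j.
case: p => [e|x p _]; first by rewrite -e eqxx in ij.
by exists x; apply/infixP; exists [::], p.
Qed.

Lemma geodesic_last_edge i j : i != j -> exists y, infix [:: y; j] (geodesic T i j).
Proof.
move=> ij; have [p [-> _ + _]] := geodesicP i j.
case/lastP: p => [e|p x]; first by rewrite -e eqxx in ij.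
rewrite last_rcons => ->; exists (last i p); apply/infixP.
by exists (belast i p), [::]; rewrite -rcons_cons lastI -!cats1 -catA.
Qed.

(** The sign of an edge at [i] records whether crossing it moves away from [j]:
an edge off the geodesic does, by [dist_other_neighbor], because the first edge
of the geodesic already takes the only neighbour of [i] closer to [j]. *)
Lemma dist_neighbor_source i j x : i != j -> adj T i x ->
  (dist T x j)%:R = (dist T i j)%:R + sigma T i j i x :> R.
Proof.
move=> ij ix; rewrite /sigma; case: ifPn => [/orP[]/geodesic_step[_]|].
- by move=> _ ->; rewrite -natr1 addrK.
- by rewrite dist_xx.
have [p1 ip1] := geodesic_first_edge ij; rewrite negb_or => /andP[nix _].
have [ip _ dp] := geodesic_step ip1.
have xp : x != p1 by apply: contra nix => /eqP->.
rewrite (dist_sym x j) (dist_other_neighbor ip ix xp) ?(dist_sym j i) ?natr1 //.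
by rewrite dp dist_sym.
Qed.

Lemma dist_neighbor_target i j y : i != j -> adj T j y ->
  (dist T i y)%:R = (dist T i j)%:R + sigma T i j j y :> R.
Proof.
move=> ij jy; rewrite /sigma; case: ifPn => [/orP[]/geodesic_step[_]|].
- by move=> _; rewrite dist_xx.
- by move=> -> _; rewrite -natr1 addrK.
have [q qj] := geodesic_last_edge ij; rewrite negb_or => /andP[_ nyj].
have [jq dq _] := geodesic_step qj.
have yq : y != q by apply: contra nyj => /eqP->.
by rewrite adj_sym in jq; rewrite natr1 (dist_other_neighbor jq jy yq dq).
Qed.

(** Dual feasibility near the two ends.  If one of [x], [y] lies on the geodesic
it is a triangle inequality; otherwise the geodesic from [x] to [y] runs through
[i] and [j], so that equality holds with [dist x y = dist i j + 2]. *)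
Lemma dist_four_point i j x y : i != j -> (x == i) || adj T i x ->
  (y == j) || adj T j y ->
  (dist T i y + dist T x j <= dist T x y + dist T i j)%N.
Proof.
move=> ij /orP[/eqP->|ix]; first by rewrite leqnn.
case/orP=> [/eqP->|jy]; first by rewrite addnC.
have [p /geodesic_step[ip _ dp]] := geodesic_first_edge ij.
have [q /geodesic_step[qj dq _]] := geodesic_last_edge ij.
have [->|xp] := eqVneq x p.
  by have := dist_triangle p i y; have := dist_adj_le1 ip; lia.
have [->|yq] := eqVneq y q.
  by have := dist_triangle q x j; have := dist_adj_le1 qj; lia.
have dx : dist T j x = (dist T j i).+1.
  by apply: (dist_other_neighbor ip ix xp); rewrite !(dist_sym j).
have jq : adj T j q by rewrite adj_sym.
(* Here [x] is squeezed: it is one step from [i], which is at distance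
   [dist i j - 1] from [q], and [q] is one step from [j]. *)
have dxj : dist T x j = (dist T x q).+1.
  have := dist_triangle i x q; have := dist_triangle q x j.
  have := dist_adj_le1 qj; have := dist_adj_le1 ix.
  by rewrite (dist_sym x i) (dist_sym x j) dx (dist_sym j i); lia.
rewrite (dist_other_neighbor jq jy yq dxj) (dist_other_neighbor jq jy yq dq).
by rewrite (dist_sym x j) dx (dist_sym j i); lia.
Qed.

End TreeDistance.

(** * Transport between lazy walks *)

Section Transport.
Variables (R : realType) (n : nat) (T : weighted_tree R n).
Implicit Types (i j x y : 'I_n) (alpha : R).

Lemma wdeg_gt0 i x : adj T i x -> 0 < wdeg T i.
Proof.
move=> ix; rewrite /wdeg (bigD1 x) //= ltr_pwDl ?weight_gt0 //.
by apply: sumr_ge0 => y /andP[iy _]; exact/ltW/weight_gt0.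
Qed.

Definition step_mean i (F : 'I_n -> R) : R :=
  \sum_(x | adj T i x) weight T i x * F x / wdeg T i.

Lemma step_mean_shift i (F G : 'I_n -> R) c x : adj T i x ->
  (forall y, adj T i y -> F y = c + G y) -> step_mean i F = c + step_mean i G.
Proof.
move=> /wdeg_gt0 w0 FE; rewrite /step_mean.
under eq_bigr => y iy do rewrite FE // mulrDr mulrDl.
by rewrite big_split /= -!mulr_suml -/(wdeg T i) mulrAC divff ?mul1r ?gt_eqF.
Qed.

Lemma lazy_walk_mean alpha i (F : 'I_n -> R) :
  \sum_x lazy_walk T alpha i x 0 * F x = alpha * F i + (1 - alpha) * step_mean i F.
Proof.
rewrite (bigD1 i) //= mxE eqxx; congr (_ + _).
rewrite /step_mean mulr_sumr big_mkcond [RHS]big_mkcond /=.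
apply: eq_bigr => x _; rewrite mxE.
have [->|_] := eqVneq x i; first by rewrite adj_irr.
by case: ifP => _ /=; [ring | rewrite mul0r].
Qed.

Lemma lazy_walk_mass alpha i x : adj T i x -> \sum_y lazy_walk T alpha i y 0 = 1.
Proof.
move=> ix; have := lazy_walk_mean alpha i (fun=> 1).
have -> : step_mean i (fun=> 1) = 1.
  rewrite (@step_mean_shift i _ (fun=> 0) 1 x) // => [|y _]; last by rewrite addr0.
  by rewrite /step_mean big1 ?addr0 // => y _; rewrite mulr0 mul0r.
by under eq_bigr do rewrite mulr1; move=> ->; ring.
Qed.

Lemma couplingP (mu nu : 'cV[R]_n) (pi : 'M[R]_n) : coupling mu nu pi <->
  [/\ forall x y, 0 <= pi x y, forall y, \sum_x pi x y = mu y 0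
    & forall x, \sum_y pi x y = nu x 0].
Proof.
have colE y : ((const_mx 1 : 'cV[R]_n)^T *m pi) 0 y = \sum_x pi x y.
  by rewrite mxE; apply: eq_bigr => x _; rewrite !mxE mul1r.
have rowE x : (pi *m (const_mx 1 : 'cV[R]_n)) x 0 = \sum_y pi x y.
  by rewrite mxE; apply: eq_bigr => y _; rewrite !mxE mulr1.
split=> -[pi0 pi1 pi2]; split=> //.
- by move=> y; rewrite -colE pi1 mxE.
- by move=> x; rewrite -rowE pi2.
- by apply/rowP => y; rewrite colE pi1 mxE.
- by apply/colP => x; rewrite rowE pi2.
Qed.

(** The sum of the two dual variables of the transport problem at [(x, y)].  In a
coupling the row index [x] is the target and the column index [y] the source,
hence the distance from [i] is taken at [x] and the distance to [j] at [y]. *)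
Definition pair_potential i j x y : R :=
  (dist T i x)%:R + (dist T y j)%:R - (dist T i j)%:R.

(** The value of the potential on the marginals: laziness contributes
[alpha * d] at each end, and the constant of the potential [- d]. *)
Definition transport_value alpha i j : R :=
  (dist T i j)%:R * (2 * alpha - 1) +
  (1 - alpha) * (step_mean i (fun x => (dist T x j)%:R) +
                 step_mean j (fun y => (dist T i y)%:R)).

Lemma coupling_potential alpha i j pi : i != j ->
  coupling (lazy_walk T alpha i) (lazy_walk T alpha j) pi ->
  \sum_x \sum_y pi x y * pair_potential i j x y = transport_value alpha i j.
Proof.
move=> ij /couplingP[_ pi1 pi2].
have [q /geodesic_step[qj _ _]] := geodesic_last_edge T ij; rewrite adj_sym in qj.
under eq_bigr => x _.
  under eq_bigr => y _ do rewrite /pair_potential addrAC mulrDr.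
  rewrite big_split /= -mulr_suml pi2; over.
rewrite big_split /= exchange_big /=.
under [X in _ + X]eq_bigr => y _ do rewrite -mulr_suml pi1.
under [X in X + _]eq_bigr => x _ do rewrite mulrBr.
rewrite big_split /= sumrN -mulr_suml (lazy_walk_mass alpha qj) !lazy_walk_mean.
by rewrite /transport_value; ring.
Qed.

(** A positive entry forces both marginals to be positive at its coordinates. *)
Lemma coupling_support alpha i j pi x y :
  coupling (lazy_walk T alpha i) (lazy_walk T alpha j) pi ->
  pi x y != 0 -> ((y == i) || adj T i y) && ((x == j) || adj T j x).
Proof.
case/couplingP=> pi0 pi1 pi2 nz; have pxy : 0 < pi x y by rewrite lt0r nz pi0.
have cy : 0 < lazy_walk T alpha i y 0.
  by rewrite -pi1 (bigD1 x) //= ltr_pwDl // sumr_ge0.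
have cx : 0 < lazy_walk T alpha j x 0.
  by rewrite -pi2 (bigD1 y) //= ltr_pwDl // sumr_ge0.
move: cx cy; rewrite !mxE.
by do 2![case: ifP => _ /=]; do ?[case: ifP => _ //=]; rewrite ?ltxx.
Qed.

(** Send all of [m_i] to [j], collect all of [m_j] from [i], and correct for the
mass counted twice by removing one unit sent from [i] to [j].  Every mass moved
then starts at [i] or ends at [j]. *)
Definition hub_coupling alpha i j : 'M[R]_n := \matrix_(x, y)
  ((x == j)%:R * lazy_walk T alpha i y 0 + lazy_walk T alpha j x 0 * (y == i)%:R
   - (x == j)%:R * (y == i)%:R).

Lemma sum_indicator (F : 'I_n -> R) j : \sum_x (x == j)%:R * F x = F j.
Proof.
rewrite (bigD1 j) //= eqxx mul1r big1 ?addr0 // => x /negPf->.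
by rewrite mul0r.
Qed.

(** The entry from [i] to [j] is [2 * alpha - 1]; the condition on [alpha] is its
nonnegativity. *)
Lemma hub_couplingP alpha i j : i != j -> 1 / 2 <= alpha -> alpha < 1 ->
  coupling (lazy_walk T alpha i) (lazy_walk T alpha j) (hub_coupling alpha i j).
Proof.
move=> ij a2 a1.
have [p /geodesic_step[ip _ _]] := geodesic_first_edge T ij.
have [q /geodesic_step[jq _ _]] := geodesic_last_edge T ij; rewrite adj_sym in jq.
have lazy_ge0 u v : 0 <= lazy_walk T alpha u v 0.
  rewrite mxE; case: ifP => _; first by lra.
  case: ifP => // uv; rewrite divr_ge0 ?mulr_ge0 ?subr_ge0 ?ltW //.
    exact: weight_gt0.
  exact: wdeg_gt0 uv.
have lazy_at u : lazy_walk T alpha u u 0 = alpha by rewrite mxE eqxx.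
apply/couplingP; split=> [x y|y|x].
- rewrite mxE; have := lazy_ge0 i y; have := lazy_ge0 j x.
  have [->|_] := eqVneq x j; have [->|_] := eqVneq y i;
    rewrite ?lazy_at ?(mulr1n, mulr0n, mul1r, mul0r, mulr1, mulr0); lra.
- under eq_bigr do rewrite mxE -addrA.
  rewrite big_split /= sum_indicator big_split /= sumrN -mulr_suml.
  by rewrite (lazy_walk_mass alpha jq) mul1r sum_indicator subrr addr0.
- under eq_bigr do rewrite mxE addrAC.
  rewrite big_split /=.
  under [X in _ + X]eq_bigr do rewrite mulrC.
  rewrite sum_indicator.
  under eq_bigr do rewrite -mulrBr.
  rewrite -mulr_sumr sumrB (lazy_walk_mass alpha ip).
  under eq_bigr do rewrite -[_%:R]mulr1.
  by rewrite sum_indicator subrr mulr0 add0r.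
Qed.

(** Complementary slackness: the potential is below the distance on the support
of every coupling, and agrees with it on the support of [hub_coupling]. *)
Lemma W1_lazy_walk alpha i j : i != j -> 1 / 2 <= alpha -> alpha < 1 ->
  W1 T (lazy_walk T alpha i) (lazy_walk T alpha j) = transport_value alpha i j.
Proof.
move=> ij a2 a1; rewrite /W1; set S := (X in inf X).
have lbS : lbound S (transport_value alpha i j).
  move=> _ [pi Cpi <-]; rewrite -(coupling_potential ij Cpi).
  apply: ler_sum => x _; apply: ler_sum => y _.
  have [->|nz] := eqVneq (pi x y) 0; first by rewrite !mul0r.
  have [pi0 _ _] := Cpi; apply: ler_wpM2l; first exact: pi0.
  have /andP[iy jx] := coupling_support Cpi nz.
  by rewrite lerBlDr -!natrD ler_nat (dist_sym T x y) dist_four_point.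
have Sv : S (transport_value alpha i j).
  have C := hub_couplingP ij a2 a1; exists (hub_coupling alpha i j) => //.
  rewrite -(coupling_potential ij C); apply: eq_bigr => x _; apply: eq_bigr => y _.
  rewrite mxE /pair_potential; have [->|_] := eqVneq x j.
    by rewrite (dist_sym T j y); ring.
  (* Away from row [j] and column [i] the coupling has no mass. *)
  have [->|_] := eqVneq y i; first by rewrite (dist_sym T x i); ring.
  by rewrite mulr0n; ring.
apply/eqP; rewrite eq_le lb_le_inf //; last by exists (transport_value alpha i j).
by rewrite andbT; apply: ge_inf => //; exists (transport_value alpha i j).
Qed.

Lemma lly_quotient_near1 alpha i j : i != j -> 1 / 2 <= alpha -> alpha < 1 ->
  lly_quotient T i j alpha =
    - ((dist T i j)%:R)^-1 *
      (step_mean i (sigma T i j i) + step_mean j (sigma T i j j)).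
Proof.
move=> ij a2 a1; rewrite /lly_quotient /ollivier_ricci W1_lazy_walk //.
have [p /geodesic_step[ip _ _]] := geodesic_first_edge T ij.
have [q /geodesic_step[jq _ _]] := geodesic_last_edge T ij; rewrite adj_sym in jq.
have d0 : (dist T i j)%:R != 0 :> R.
  by rewrite pnatr_eq0; apply: contra ij => /eqP/dist_eq0->.
rewrite /transport_value.
rewrite (step_mean_shift ip (fun x => dist_neighbor_source ij (x:=x))).
rewrite (step_mean_shift jq (fun y => dist_neighbor_target ij (y:=y))).
by field; rewrite d0 subr_eq0 gt_eqF.
Qed.

End Transport.

(** * The curvature formula *)

Theorem corollary3p5 (R : realType) (n : nat) (T : weighted_tree R n)
    (i j : 'I_n) (neq_ij : i <> j) :
  cvg (lly_quotient T i j alpha @[alpha --> 1^'-]) /\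
  lin_lu_yau T i j =
    - ((dist T i j)%:R)^-1 *
      (\sum_(x | adj T i x) weight T i x * sigma T i j i x / wdeg T i +
       \sum_(y | adj T j y) weight T j y * sigma T i j j y / wdeg T j).
Proof.
have ij : i != j by apply/eqP.
rewrite -/(step_mean T i _) -/(step_mean T j _); set c := (X in _ = X).
have cvg_c : lly_quotient T i j alpha @[alpha --> 1^'-] --> c.
  apply: cvg_near_cst; near=> alpha; apply: lly_quotient_near1 => //.
  near: alpha; apply: nbhs_left_ge; lra.
by split; [apply/cvg_ex; exists c | exact/cvg_lim].
Unshelve. all: by end_near. Qed.
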